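(* Let $d\ge s\ge 1$ be integers and let $L$ be a $\Diamond$-lattice of rank $d+1$ that has exactly $d+s$ atoms. For $k\ge -1$ let $f_k(L)$ denote the number of elements of $L$ of rank $k+1$. Then for every integer $k$ with $-1\le k\le d$, $$f_k(L)\ \ge\ \phi_k(d+s,d):=\binom{d+1}{k+1}+\binom{d}{k+1}-\binom{d+1-s}{k+1}.$$
   Context: All posets are finite, graded (all maximal chains have the same length) and bounded, with bottom element $\hat 0$ and top element $\hat 1$. The rank function $\rho$ satisfies $\rho(\hat 0)=0$, and the rank of $L$ is $\rho(\hat 1)$. A lattice is a poset in which every pair of elements has a least upper bound and a greatest lower bound. For $x\le y$, the interval $[x,y]$ is $\{z: x\le z\le y\}$ and its rank is $\rho(y)-\rho(x)$. A diamond lattice, or $\Diamond$-lattice, is a (finite, bounded) graded lattice all of whose rank-$2$ intervals have exactly four elements. Atoms are the elements of rank $1$. The convention $\binom{n}{j}=0$ for $0\le n<j$ is used. *)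

(* Defs.v *)
From mathcomp Require Import all_boot all_order all_algebra.

Set Implicit Arguments.
Unset Strict Implicit.
Unset Printing Implicit Defensive.

Import Order.TTheory GRing.Theory Num.Theory.

Section Posets.

Variables (disp : Order.disp_t) (P : finPOrderType disp).
Implicit Types (x y : P) (C D : {set P}).

Definition chain C : bool :=
  [forall x in C, forall y in C, (x >=< y)%O].

Definition maximal_chain C : bool := maxset chain C.

(* The length of a finite chain C is #|C|.-1; as P is finite, equality of
   lengths of nonempty chains is equality of cardinals. *)
Definition graded : Prop :=
  forall C D, maximal_chain C -> maximal_chain D -> #|C| = #|D|.

(* Length of a longest chain of elements below x.  When P is graded with a
   bottom element, this is the rank function vanishing at the bottom. *)
Definition rank x : nat :=
  (\max_(C : {set P} | chain C && (C \subset [set z | (z <= x)%O])) #|C|).-1.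

Definition itv x y : {set P} := [set z | (x <= z <= y)%O].

Definition atoms : {set P} := [set x | rank x == 1].

Definition fnum (k : int) : nat := #|[set x : P | ((rank x)%:Z == k + 1)%R]|.

End Posets.

Arguments graded {disp} P.
Arguments atoms {disp} P.
Arguments fnum {disp} P k.

Definition diamond_lattice (disp : Order.disp_t) (L : finTBLatticeType disp) :
    Prop :=
  graded L /\
  forall x y : L, (x <= y)%O -> rank y - rank x = 2 -> #|itv x y| = 4.

(* phi k d s is $\phi_k(d+s,d)$.  It is meant for k >= -1, where the absolute
   value only turns the nonnegative integer k + 1 into a natural number. *)
Definition phi (k : int) (d s : nat) : int :=
  let j := `|(k + 1)%R|%N in
  ('C(d + 1, j)%:Z + 'C(d, j)%:Z - 'C(d + 1 - s, j)%:Z)%R.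

(* Main.v *)
(** The elements above an atom [v] and below an element [F] of rank [r] include
    at least ['C(r - 1, j)] elements of rank [j + 1].  Given atoms
    [v_1, ..., v_m], the diamond property provides [F_i] above [v_i], of corank
    [i - 1], and above none of [v_1, ..., v_(i-1)]; counting in the intervals
    [[v_i, F_i]] bounds from below the number of elements lying above at least
    one of the [v_i].

    The theorem follows by induction on the rank.  If [s = 1] the bound is
    that of a Boolean lattice.  If [s >= 2], some coatom misses [m >= 2] atoms:
    otherwise so do all coatoms of all its lower intervals, and there are no
    more atoms than the rank.  The induction hypothesis counts the elements
    below this coatom, the first paragraph those above a missed atom, and the
    two bounds add up to the claim by convexity of binomial coefficients. *)
Require Import Defs.
From mathcomp Require Import all_boot all_order all_algebra.
From mathcomp Require Import zify.
Import Order.TTheory GRing.Theory Num.Theory.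

Set Implicit Arguments.
Unset Strict Implicit.
Unset Printing Implicit Defensive.

(** By Pascal's rule, raising the upper index [n] by one adds a binomial coefficient that is itself
    nondecreasing in [n]; induction on [u] adds up these increments. *)
Lemma bin_convex (p u v j : nat) :
  'C(p + u, j) + 'C(p + v, j) <= 'C(p, j) + 'C(p + u + v, j).
Proof.
elim: u => [|u IH]; first by rewrite !addn0.
case: j IH => [|j] IH; first by rewrite !bin0.
rewrite addnS addSn !binS.
have := @leq_bin2l (p + u) (p + u + v) j (leq_addr _ _).
lia.
Qed.

(** * Rank and covers in graded posets *)

Section Rank.

Context {disp : Order.disp_t} {P : finPOrderType disp}.
Implicit Types (x y z : P) (C : {set P}).

Lemma chainP C : reflect {in C &, forall x y, (x >=< y)%O} (chain C).
Proof.
apply: (iffP forall_inP) => [H x y xC yC|H x xC].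
  by move/forall_inP: (H x xC); apply.
by apply/forall_inP => y yC; apply: H.
Qed.

Lemma chain_sub C C' : C' \subset C -> chain C -> chain C'.
Proof.
move=> /subsetP CC /chainP cC; apply/chainP => x y xC yC.
by apply: cC; apply: CC.
Qed.

Lemma chainU1 x C : chain C -> {in C, forall z, (x >=< z)%O} -> chain (x |: C).
Proof.
move=> /chainP cC xC; apply/chainP => a b; rewrite !inE.
move=> /orP[/eqP->|aC] /orP[/eqP->|bC].
- exact: comparablexx.
- exact: xC.
- by rewrite comparable_sym xC.
- exact: cC.
Qed.

Lemma rank_ge x C :
  chain C -> {in C, forall z, (z <= x)%O} -> #|C| <= (rank x).+1.
Proof.
move=> cC Cx; apply: leq_trans (leqSpred _).
apply: (@leq_bigmax_cond _ _ (fun C : {set P} => #|C|)).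
by rewrite cC; apply/subsetP => z /Cx; rewrite inE.
Qed.

Lemma rank_chain x :
  exists C, [/\ chain C, {in C, forall z, (z <= x)%O} & #|C| = (rank x).+1].
Proof.
pose Q C := chain C && (C \subset [set z | (z <= x)%O]).
have Q1 : Q [set x].
  apply/andP; split; last by rewrite sub1set inE.
  by apply/chainP => a b /set1P-> /set1P->; apply: comparablexx.
have [|C /andP[cC /subsetP Cx] EC] :=
    @eq_bigmax_cond _ Q (fun C : {set P} => #|C|).
  by apply/card_gt0P; exists [set x].
exists C; split=> //; first by move=> z /Cx; rewrite inE.
rewrite /rank EC prednK // -EC.
by apply: leq_trans (@leq_bigmax_cond _ Q (fun C : {set P} => #|C|) _ Q1);
  rewrite cards1.
Qed.

Lemma rank_lt x y : (x < y)%O -> rank x < rank y.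
Proof.
move=> xy; have [C [cC Cx EC]] := rank_chain x.
have yC : y \notin C.
  by apply/negP => /Cx; rewrite lt_geF.
rewrite -ltnS -EC -add1n -[_ + _]/(true + _) -yC -cardsU1.
apply: rank_ge.
  by apply: chainU1 => // z /Cx zx; rewrite ge_comparable // ltW // (le_lt_trans zx).
move=> z; rewrite !inE => /orP[/eqP->//|/Cx zx].
by rewrite ltW // (le_lt_trans zx).
Qed.

Lemma rank_le x y : (x <= y)%O -> rank x <= rank y.
Proof. by rewrite le_eqVlt => /predU1P[->//|/rank_lt/ltnW]. Qed.

Lemma eq_rank_le x y : (x <= y)%O -> rank y <= rank x -> x = y.
Proof.
by rewrite le_eqVlt => /predU1P[//|/rank_lt]; rewrite ltnNge => /negbTE->.
Qed.

Lemma maximal_chain_mem C z :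
  maximal_chain C -> {in C, forall x, (z >=< x)%O} -> z \in C.
Proof.
move=> /maxsetP[cC mC] zC.
by rewrite -(mC (z |: C)) ?subsetUr ?setU11 //; apply: chainU1.
Qed.

(* Replacing the part of [C] below [y] by a longest chain below [y] gives
   another maximal chain. *)
Lemma rank_maximal_chain C y : graded P -> maximal_chain C -> y \in C ->
  #|[set z in C | (z <= y)%O]| = (rank y).+1.
Proof.
move=> gP mC yC; have cC := maxsetp mC; have/chainP cC' := cC.
have [B [cB By EB]] := rank_chain y.
pose U := [set z in C | ~~ (z <= y)%O].
have U_gt z : z \in U -> (y < z)%O.
  rewrite inE => /andP[zC zy].
  by have := cC' z y zC yC; case: comparableP zy.
have BU : [disjoint B & U].
  rewrite disjoint_subset; apply/subsetP => z /By zy.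
  by rewrite !inE zy andbF.
have cBU : chain (B :|: U).
  apply/chainP => a b; rewrite !inE => /orP[aB|aU] /orP[bB|bU].
  - by move/chainP: cB; apply.
  - have yb : (y < b)%O by apply: U_gt; rewrite inE.
    by apply: le_comparable; rewrite (le_trans (By _ aB)) ?ltW.
  - have ya : (y < a)%O by apply: U_gt; rewrite inE.
    by apply: ge_comparable; rewrite (le_trans (By _ bB)) ?ltW.
  - by case/andP: aU => aC _; case/andP: bU => bC _; apply: cC'.
(* A longest chain below [y] already contains every element below [y] that is comparable to all of
   it, in particular [y] itself. *)
have B_mem z : (z <= y)%O -> {in B, forall x, (z >=< x)%O} -> z \in B.
  move=> zy zB; apply/negPn/negP => nzB.
  suff : #|z |: B| <= (rank y).+1 by rewrite cardsU1 nzB EB ltnn.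
  apply: rank_ge; first exact: chainU1.
  by move=> x; rewrite !inE => /orP[/eqP->//|/By].
have mBU : maximal_chain (B :|: U).
  apply/maxsetP; split=> // D /chainP cD sD; apply/eqP.
  rewrite eqEsubset sD andbT; apply/subsetP => z zD.
  have zBU x : x \in B :|: U -> (z >=< x)%O.
    by move/(subsetP sD); apply: cD.
  have yB : y \in B.
    by apply: B_mem => // x /By xy; rewrite ge_comparable.
  have := zBU y; rewrite !inE yB => /(_ isT) /=.
  case: (boolP (z <= y)%O) => [zy _|zy /comparable_leP].
    rewrite B_mem // => x xB; apply: zBU.
    by rewrite inE xB.
  move=> zy'; rewrite andbT; apply/orP; right.
  have yz : (y <= z)%O by case: zy' zy => // /ltW.
  apply: maximal_chain_mem => // x xC.
  have [xy|xy] := boolP (x <= y)%O.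
    by rewrite ge_comparable // (le_trans xy).
  by apply: zBU; rewrite !inE xC xy orbT.
(* Both maximal chains have the same size and share the part [U], so their parts below [y] have
   equal sizes. *)
have := gP _ _ mC mBU.
rewrite cardsU disjoint_setI0 // cards0 subn0 EB.
rewrite -(cardsID [set z | (z <= y)%O] C).
have -> : C :\: [set z | (z <= y)%O] = U.
  by apply/setP => z; rewrite !inE andbC.
have -> : C :&: [set z | (z <= y)%O] = [set z in C | (z <= y)%O].
  by apply/setP => z; rewrite !inE.
by move/addIn.
Qed.

(** In a maximal chain through [x] and [y], the elements below [y] other than [y] are exactly those
    below [x]. *)
Lemma rank_cover x y : graded P -> (x < y)%O ->
  (forall z, (x < z)%O -> (z < y)%O -> False) -> rank y = (rank x).+1.
Proof.
move=> gP xy cov; have c2 : chain [set x; y].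
  apply: chainU1 => [|z /set1P->]; last by rewrite lt_comparable.
  by apply/chainP => a b /set1P-> /set1P->; apply: comparablexx.
have [C mC sC] := maxset_exists c2.
have xC : x \in C by rewrite (subsetP sC) // !inE eqxx.
have yC : y \in C by rewrite (subsetP sC) // !inE eqxx orbT.
have /chainP cC := maxsetp mC.
have := rank_maximal_chain gP mC yC; rewrite -(rank_maximal_chain gP mC xC).
rewrite (cardsD1 y) !inE yC lexx /= add1n => -[<-].
apply: eq_card => z; rewrite !inE.
case: (boolP (z \in C)) => zC; rewrite ?andbF //=.
rewrite -lt_neqAle; apply/idP/idP => [zy|zx]; last exact: le_lt_trans zx xy.
by case: (comparable_leP (cC _ _ zC xC)) => // xz; case: (cov z).
Qed.

Lemma cover_up x y : graded P -> (x < y)%O ->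
  exists z, [/\ (x < z)%O, (z <= y)%O & rank z = (rank x).+1].
Proof.
move=> gP xy; pose Q z := (x < z <= y)%O.
have Qy : Q y by rewrite /Q xy lexx.
have [z /andP[xz zy] zmin] := arg_minnP (@rank _ P) Qy.
exists z; split=> //; apply: rank_cover => // w xw wz.
have := zmin w; rewrite /Q xw (ltW (lt_le_trans wz zy)) => /(_ isT) /=.
by rewrite leqNgt rank_lt.
Qed.

Lemma cover_down x y : graded P -> (x < y)%O ->
  exists z, [/\ (x <= z)%O, (z < y)%O & rank y = (rank z).+1].
Proof.
move=> gP xy; pose Q z := (x <= z < y)%O.
have Qx : Q x by rewrite /Q xy lexx.
have [z /andP[xz zy] zmax] := arg_maxnP (@rank _ P) Qx.
exists z; split=> //; apply: rank_cover => // w zw wy.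
have := zmax w; rewrite /Q wy (ltW (le_lt_trans xz zw)) => /(_ isT) /=.
by rewrite leqNgt rank_lt.
Qed.

End Rank.

(** * Intervals of a diamond lattice and elements that avoid given ones *)

Section Diamond.

Context {disp : Order.disp_t} {L : finTBLatticeType disp}.
Context (hL : diamond_lattice L).
Implicit Types (x y z v w a : L) (j m r : nat).

Let gL : graded L := hL.1.

Lemma rank_bot : rank (\bot : L)%O = 0.
Proof.
have [C [_ Cx EC]] := rank_chain (\bot : L)%O.
have : #|C| <= #|[set \bot : L]%O|.
  by apply/subset_leq_card/subsetP => z /Cx; rewrite lex0 inE.
by rewrite cards1 EC; case: (rank _).
Qed.

Lemma diamond_other x y z : (x <= y)%O -> rank y = (rank x).+2 ->
  exists w, [/\ (x < w)%O, (w < y)%O, rank w = (rank x).+1 & w != z].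
Proof.
move=> xy rxy; have c4 : #|itv x y| = 4.
  by apply: hL.2 => //; rewrite rxy -addn2 addKn.
have : 0 < #|itv x y :\: [set x; y; z]|.
  have c3 : #|[set x; y; z]| <= 3.
    by apply: leq_trans (leq_card_setU _ _) _; rewrite cards1 cards2; case: eqP.
  rewrite card_gt0 setD_eq0; apply/negP => /subset_leq_card/leq_trans/(_ c3).
  by rewrite c4.
case/card_gt0P => w; rewrite !inE !negb_or -!andbA => /and5P[wx wy wz xw w'y].
have xw' : (x < w)%O by rewrite lt_neqAle eq_sym wx.
have wy' : (w < y)%O by rewrite lt_neqAle wy.
exists w; split=> //; have := rank_lt xw'; have := rank_lt wy'.
by rewrite rxy; lia.
Qed.

(** A meet strictly above [x] would have the rank of [z] and of [w], hence be equal to both. *)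
Lemma meet_covers x z w : (x < z)%O -> (x < w)%O -> z != w ->
  rank z = (rank x).+1 -> rank w = (rank x).+1 -> (z `&` w = x)%O.
Proof.
move=> xz xw zw rz rw; have : (x <= z `&` w)%O by rewrite lexI !ltW.
rewrite le_eqVlt => /predU1P[->//|/rank_lt lt_m].
have mz : (z `&` w)%O = z by apply: eq_rank_le (leIl _ _) _; rewrite rz.
have mw : (z `&` w)%O = w by apply: eq_rank_le (leIr _ _) _; rewrite rw.
by rewrite -mz {1}mw eqxx in zw.
Qed.

(** Take [z] of largest rank in [[x, y]] among the elements not above [w]. If [z] were not a coatom
    of [y], a rank-2 interval starting at [z] would contain two covers of [z]; both lie above [w] by
    maximality, and so does their meet [z]. *)
Lemma coatom_avoiding x y w : (x <= y)%O -> (w <= y)%O -> ~~ (w <= x)%O ->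
  exists h, [/\ (x <= h)%O, (h < y)%O, rank y = (rank h).+1 & ~~ (w <= h)%O].
Proof.
move=> xy wy wx; pose Q z := [&& (x <= z)%O, (z <= y)%O & ~~ (w <= z)%O].
have Qx : Q x by rewrite /Q lexx xy.
have [z /and3P[xz zy wz] zmax] := arg_maxnP (@rank _ L) Qx.
have Nzy : z != y by apply: contra wz => /eqP->.
have ltzy : (z < y)%O by rewrite lt_neqAle Nzy.
exists z; split=> //.
have above u : (z < u)%O -> (u <= y)%O -> (w <= u)%O.
  move=> zu uy; apply/negPn/negP => wu.
  have := zmax u; rewrite /Q wu uy (le_trans xz (ltW zu)) => /(_ isT) /=.
  by rewrite leqNgt rank_lt.
have [z1 [zz1 z1y rz1]] := cover_up gL ltzy.
move: z1y; rewrite le_eqVlt => /predU1P[<-//|z1y].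
have [z2 [z12 z2y rz2]] := cover_up gL z1y.
have [|z1' [zz1' z1'2 rz1' N1]] :=
    @diamond_other z z2 z1 (ltW (lt_trans zz1 z12)); first by rewrite rz2 rz1.
case/negP: wz; rewrite -(meet_covers zz1' zz1 N1 rz1' rz1) lexI.
by rewrite !above // ltW // (lt_le_trans z1'2).
Qed.

(** Pascal's rule: for a cover [a] of [x] and a coatom [h] of [y] that is not above [a], the
    intervals [[a, y]] and [[x, h]] are disjoint and both of rank one less. *)
Lemma binomial_le_interval x y r j : (x <= y)%O -> rank y = rank x + r ->
  'C(r, j) <= #|[set z in itv x y | rank z == rank x + j]|.
Proof.
elim: r x y j => [|r IH] x y [|j] xy rxy; rewrite ?bin0 //.
- by apply/card_gt0P; exists x; rewrite !inE xy lexx addn0 eqxx.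
- by apply/card_gt0P; exists x; rewrite !inE xy lexx addn0 eqxx.
have ltxy : (x < y)%O.
  by rewrite lt_neqAle xy andbT; apply/eqP => E; move: rxy; rewrite E; lia.
have [a [xa ay ra]] := cover_up gL ltxy.
have ax : ~~ (a <= x)%O by rewrite lt_geF.
have [h [xh hy rh ah]] := coatom_avoiding xy ay ax.
have H1 := IH a y j ay; have H2 := IH x h j.+1 xh.
rewrite binS addnC; apply: leq_trans (leq_add (H1 _) (H2 _)) _; try lia.
set A := [set z in itv a y | _]; set B := [set z in itv x h | _].
have AB : A :&: B = set0.
  apply/setP => z; rewrite !inE; apply/negP.
  case/andP => /andP[/andP[az _] _] /andP[/andP[_ zh] _].
  by rewrite (le_trans az zh) in ah.
rewrite -[X in X <= _]subn0 -(cards0 L) -AB -cardsU.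
apply/subset_leq_card/subsetP => z; rewrite !inE.
case/orP => /andP[/andP[z1 z2] /eqP rz].
  by rewrite (le_trans (ltW xa) z1) z2 rz ra addSnnS eqxx.
by rewrite z1 (le_trans z2 (ltW hy)) rz eqxx.
Qed.

Lemma avoiding v y (s : seq L) : (v <= y)%O ->
  {in s, forall u, ~~ (u <= v)%O} -> rank v + size s <= rank y ->
  exists f, [/\ (v <= f)%O, (f <= y)%O, rank f + size s = rank y
    & {in s, forall u, ~~ (u <= f)%O}].
Proof.
move=> vy; elim: s => [|u s IH] sv /= sz; first by exists y; split; lia || done.
have [||f [vf fy rf sf]] := IH.
- by move=> w ws; apply: sv; rewrite inE ws orbT.
- by lia.
(* The corank must grow by exactly one even if [f] already avoids [u]. In that case [w] is [f], and
   any coatom of [f] above [v] will do. *)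
pose w := if (u <= f)%O then u else f.
have wf : (w <= f)%O by rewrite /w; case: ifP.
have wv : ~~ (w <= v)%O.
  rewrite /w; case: ifP => _; first by apply: sv; rewrite inE eqxx.
  by apply/negP => /rank_le; lia.
have [h [vh hf rh wh]] := coatom_avoiding vf wf wv.
exists h; split=> //; first exact: le_trans (ltW hf) fy.
  by lia.
move=> a; rewrite inE => /predU1P[->|/sf].
  move: wh; rewrite /w; case: ifP => // uf _.
  by apply/negP => /le_trans/(_ (ltW hf)); rewrite uf.
by apply: contra => /le_trans; apply; apply: ltW.
Qed.

(** For the head [a] of the list, [avoiding] gives [f] above [a], of corank the length of the tail
    and above no atom of the tail. So [[a, f]] contributes only elements not yet counted, and by
    Pascal's rule the contributions telescope. *)
Lemma binomial_le_above_atoms y (s : seq L) j :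
  uniq s -> {in s, forall a, rank a = 1 /\ (a <= y)%O} -> size s <= rank y ->
  'C(rank y, j.+1) <= 'C(rank y - size s, j.+1)
    + #|[set z | [&& (z <= y)%O, rank z == j.+1 & has (fun a => a <= z)%O s]]|.
Proof.
elim: s => [|a s IH] /=; first by rewrite subn0 leq_addr.
case/andP=> Nas us sy sz.
have [ra ay] : rank a = 1 /\ (a <= y)%O by apply: sy; rewrite inE eqxx.
have sy' : {in s, forall b, rank b = 1 /\ (b <= y)%O}.
  by move=> b bs; apply: sy; rewrite inE bs orbT.
have sa : {in s, forall u, ~~ (u <= a)%O}.
  move=> u us'; apply/negP => ua; have [ru _] := sy' u us'.
  have E : u = a by apply: eq_rank_le; rewrite // ru ra.
  by rewrite -E us' in Nas.
have [|f [af fy rf sf]] := avoiding ay sa; first by rewrite ra.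
have := IH us sy' (ltnW sz).
have /= Hf := @binomial_le_interval a f (rank f).-1 j af.
have {}Hf := Hf ltac:(move: (rank_le af); lia).
have -> : rank y - size s = (rank y - (size s).+1).+1 by lia.
rewrite binS; have -> : rank y - (size s).+1 = (rank f).-1 by lia.
move=> /leq_trans; apply; rewrite -addnA leq_add2l.
apply: leq_trans (leq_add Hf (leqnn _)) _.
set A := [set z in itv a f | _]; set B := [set z | _].
have AB : A :&: B = set0.
  apply/setP => z; rewrite !inE; apply/negP.
  case/andP => /andP[/andP[_ zf] _] /and3P[_ _ /hasP[u us' uz]].
  by have := sf u us'; rewrite (le_trans uz zf).
rewrite -[X in X <= _]subn0 -(cards0 L) -AB -cardsU.
apply/subset_leq_card/subsetP => z; rewrite !inE.
case/orP => [/andP[/andP[z1 z2] /eqP rz]|/and3P[-> -> ->]]; last by rewrite orbT.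
by rewrite z1 (le_trans z2 fy) rz ra add1n eqxx.
Qed.

(** * Atoms below an element, and the induction on the rank *)

Definition atoms_below y : {set L} := [set a in atoms L | (a <= y)%O].

Lemma rank_le_atoms y : rank y <= #|atoms_below y|.
Proof.
have := @binomial_le_interval \bot%O y (rank y) 1 (le0x _).
rewrite rank_bot bin1 => /(_ erefl) /leq_trans; apply.
apply/subset_leq_card/subsetP => z.
by rewrite !inE le0x /= andbC.
Qed.

(** The hypothesis passes to a coatom [x] of [y]: if [z] is a coatom of [x], the interval [[z, y]]
    has a second coatom [w], and [w] and [x] meet in [z]. An atom below [x] but not below [z] is
    therefore missed by [w]. *)
Lemma atoms_le_rank y :
  (forall x, (x < y)%O -> rank y = (rank x).+1 ->
     #|atoms_below y :\: atoms_below x| <= 1) ->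
  #|atoms_below y| <= rank y.
Proof.
move En : (rank y) => n; elim: n y En => [|n IH] y rn Hy.
  rewrite leqn0 cards_eq0; apply/eqP/setP => a; rewrite !inE.
  by apply/negP => /andP[/eqP ra /rank_le]; rewrite ra rn.
have ltby : (\bot < y)%O.
  by rewrite lt0x; apply/eqP => E; move: rn; rewrite E rank_bot.
have [x [_ xy rx]] := cover_down gL ltby.
have {}rx : rank x = n by lia.
have := Hy x xy; rewrite rx => /(_ erefl) H1.
have H2 : #|atoms_below x| <= n.
  apply: IH => // z zx rz.
  have [|w [zw wy rw wx]] :=
      @diamond_other z y x (ltW (lt_trans zx xy)); first by lia.
  apply: leq_trans (Hy w wy _); last by lia.
  apply/subset_leq_card/subsetP => a; rewrite !inE.
  case/andP; rewrite negb_and => /orP[/negbTE->//|az] /andP[-> ax].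
  rewrite (le_trans ax (ltW xy)) !andbT /=.
  apply: contra az => aw.
  rewrite -(meet_covers zw zx wx rw) ?lexI ?aw ?ax //.
  by lia.
have := cardsID (atoms_below x) (atoms_below y).
have : #|atoms_below y :&: atoms_below x| <= #|atoms_below x|.
  exact/subset_leq_card/subsetIr.
by lia.
Qed.

Lemma coatom_missing_two y : rank y < #|atoms_below y| ->
  exists x, [/\ (x < y)%O, rank y = (rank x).+1
    & 1 < #|atoms_below y :\: atoms_below x|].
Proof.
move=> lt_y; pose Q x := [&& (x < y)%O, rank y == (rank x).+1
  & 1 < #|atoms_below y :\: atoms_below x|].
have [x /and3P[xy /eqP rx mx]|nQ] := pickP Q; first by exists x.
suff : #|atoms_below y| <= rank y by rewrite leqNgt lt_y.
apply: atoms_le_rank => x xy rx; rewrite leqNgt; apply/negP => mx.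
by have := nQ x; rewrite /Q xy rx eqxx mx.
Qed.

(** The claim is stated below an arbitrary [y] so that induction can pass to a coatom; moving the
    negative term across avoids truncated subtraction. *)
Lemma lower_bound y d s j : 0 < s <= d -> rank y = d.+1 ->
  #|atoms_below y| = d + s ->
  'C(d.+1, j) + 'C(d, j)
    <= #|[set z : L | (z <= y)%O && (rank z == j)]| + 'C(d.+1 - s, j).
Proof.
elim: d y s => [|d IH] y s hs ry hy; first by lia.
have Nbin : 'C(d.+2, j) <= #|[set z : L | (z <= y)%O && (rank z == j)]|.
  have := @binomial_le_interval \bot%O y d.+2 j (le0x _).
  rewrite rank_bot => /(_ ry) /leq_trans; apply.
  by apply/subset_leq_card/subsetP => z; rewrite !inE le0x.
(* For [s = 1] the last two binomials cancel and [Nbin] remains. Rank [j = 0] is also separate, as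
   no element of rank 0 lies above an atom. *)
have [s1|s1] := leqP s 1.
  have -> : s = 1 by lia.
  by rewrite subn1 leq_add2r.
case: j IH Nbin => [|j] IH Nbin; first by move: Nbin; rewrite !bin0; lia.
have [|x [xy rx]] := @coatom_missing_two y; first by lia.
set M := _ :\: _ => m2.
have EM : #|atoms_below x| + #|M| = d.+1 + s.
  rewrite -hy -(cardsID (atoms_below x) (atoms_below y)); congr addn.
  apply: eq_card => a; rewrite !inE; case: (rank a == 1) => //=.
  by apply/idP/andP => [ax|[]//]; split=> //; apply: le_trans ax (ltW xy).
have Hx := rank_le_atoms x.
(* This parameter matches the number of atoms below [x]. It is at least 1 since [Hx] forces
   [#|M| <= s], and at most [d] since [#|M|] is at least 2. *)
have {IH} := IH x (s - #|M| + 1).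
have EI : d + (s - #|M| + 1) = d.+1 + s - #|M| by lia.
rewrite EI => IH; have {}IH := IH ltac:(lia) ltac:(lia) ltac:(lia).
have /= := @binomial_le_above_atoms y (enum M) j (enum_uniq _).
rewrite -cardE ry => HM.
have {}HM := HM ltac:(move=> a; rewrite mem_enum !inE => /andP[_ /andP[/eqP]]; by split)
  ltac:(lia).
(* Convexity compares the two error terms, with upper indices [d.+1 - (s - #|M| + 1)] and
   [d.+2 - #|M|], with those of upper indices [d.+2 - s] and [d], which have the same sum. *)
have := bin_convex (d.+2 - s) (#|M| - 2) (s - #|M|) j.+1.
have -> : d.+2 - s + (#|M| - 2) = d.+1 - (s - #|M| + 1) by lia.
have -> : d.+2 - s + (s - #|M|) = d.+2 - #|M| by lia.
have -> : d.+1 - (s - #|M| + 1) + (s - #|M|) = d by lia.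
move: HM IH; set A := [set z | _]; set B := [set z | _]; set F := [set z | _].
suff : #|B| + #|A| <= #|F| by clear; move: #|A| #|B| #|F|; lia.
(* Elements of [B] lie below [x], while those of [A] lie above an atom that [x] misses. *)
have BA : B :&: A = set0.
  apply/setP => z; rewrite !inE; apply/negP.
  case/andP => /andP[zx _] /and3P[_ _ /hasP[a]].
  rewrite mem_enum !inE => /andP[Na /andP[ra _]] az.
  by rewrite ra (le_trans az zx) in Na.
rewrite -[X in X <= _]subn0 -(cards0 L) -BA -cardsU.
apply/subset_leq_card/subsetP => z; rewrite !inE.
case/orP => [/andP[zx ->]|/and3P[-> -> _]//].
by rewrite (le_trans zx (ltW xy)).
Qed.

End Diamond.

Unset Implicit Arguments.

Theorem theorem3p6 (disp : Order.disp_t) (L : finTBLatticeType disp)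
    (d s : nat) (hs : 1 <= s) (hsd : s <= d)
    (hL : diamond_lattice L)
    (hrank : rank (\top : L)%O = d + 1)
    (hatoms : #|atoms L| = d + s)
    (k : int) (hk1 : (-1 <= k)%R) (hkd : (k <= d%:Z)%R) :
  ((fnum L k)%:Z >= phi k d s)%R.
Proof.
rewrite addn1 in hrank; rewrite /phi addn1; set j := `|_|%N.
have Ek : (k + 1 = j%:Z)%R by rewrite /j; lia.
have hA : #|atoms_below (\top : L)%O| = d + s.
  by rewrite -hatoms; apply: eq_card => a; rewrite !inE lex1 andbT.
have := @lower_bound _ L hL _ d s j _ hrank hA.
rewrite hs hsd => /(_ isT) /=.
have -> : #|[set z : L | (z <= \top)%O && (rank z == j)]| = fnum L k.
  by apply: eq_card => z; rewrite !inE lex1 Ek.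
by lia.
Qed.
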